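(* Let $n\ge 2$ be an integer. For every $(\gamma,c)\in\operatorname{BS}(1,n)=\mathbb{Z}\left[\tfrac1n\right]\rtimes\mathbb{Z}$ and every integer $k\ge 1$, $\operatorname{Stab}\big((\gamma,c)\big)=\operatorname{Stab}\big((\gamma,c)^k\big)$.
   Context: $\mathbb{Z}\left[\tfrac1n\right]=\{l/n^k\mid l\in\mathbb{Z},k\ge 0\}\subset\mathbb{Q}$ (as an additive group). The Baumslag--Solitar group $\operatorname{BS}(1,n)$ is identified with the set of pairs $(\gamma,c)$, $\gamma\in\mathbb{Z}\left[\tfrac1n\right]$, $c\in\mathbb{Z}$, with product $(\gamma_1,c_1)(\gamma_2,c_2)=(\gamma_1n^{c_2}+\gamma_2,\;c_1+c_2)$. For a group $G$ and $g\in G$, $\operatorname{Stab}(g)=\{\varphi\in\operatorname{Aut}(G)\mid\varphi(g)=g\}$. *)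

(* Defs.v *)
From HB Require Import structures.
From mathcomp Require Import all_boot all_order all_algebra.
From mathcomp Require Import boolp classical_sets.

Set Implicit Arguments.
Unset Strict Implicit.
Unset Printing Implicit Defensive.

Import GRing.Theory.
Local Open Scope ring_scope.

Definition Zinv_pred (n : nat) : {pred rat} :=
  fun x => `[< exists (l : int) (k : nat), x = l%:~R / n%:R ^+ k >].

Lemma Zinv_predP n (x : rat) :
  reflect (exists (l : int) (k : nat), x = l%:~R / n%:R ^+ k)
          (x \in Zinv_pred n).
Proof. exact: asboolP. Qed.

(* For n = 0 the rational 0 has inverse 0, so division by n ^+ k is total and
   the closure lemmas below hold for every n. *)
Lemma Zinv_zmod_closed n : zmod_closed (Zinv_pred n).
Proof.
split; first by apply/Zinv_predP; exists 0, 0%N; rewrite mul0r.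
move=> x y /Zinv_predP[l [i ->]] /Zinv_predP[m [j ->]]; apply/Zinv_predP.
have [->|n0] := eqVneq n 0%N.
  case: i => [|i]; case: j => [|j]; rewrite ?exprS ?mul0r ?invr0 ?mulr0.
  - by exists (l - m), 0%N; rewrite !expr0 !divr1 rmorphB.
  - by exists l, 0%N; rewrite subr0.
  - by exists (- m), 0%N; rewrite sub0r rmorphN mulNr.
  - by exists 0, 0%N; rewrite subr0 mul0r.
have nu k : (n%:R : rat) ^+ k != 0 by rewrite expf_neq0 // Num.Theory.pnatr_eq0.
exists (l * n%:R ^+ j - m * n%:R ^+ i), (i + j)%N.
rewrite rmorphB !rmorphM !rmorphXn /= !rmorph_nat exprD mulrBl -mulf_div.
rewrite (mulrC (n%:R ^+ i)) -mulf_div.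
by rewrite !divff // !mulr1.
Qed.

HB.instance Definition _ n :=
  GRing.isZmodClosed.Build rat (Zinv_pred n) (Zinv_zmod_closed n).

Record Zinv (n : nat) := MkZinv {
  Zinv_val :> rat;
  Zinv_valP : Zinv_val \in Zinv_pred n
}.

HB.instance Definition _ n := [isSub for @Zinv_val n].
HB.instance Definition _ n := [Choice of Zinv n by <:].
HB.instance Definition _ n := [SubChoice_isSubZmodule of Zinv n by <:].

Lemma Zinv_mul_closed n (x : Zinv n) (c : int) :
  val x * n%:R ^ c \in Zinv_pred n.
Proof.
case: x => x /= /Zinv_predP[l [i ->]]; apply/Zinv_predP; case: c => c.
  exists (l * n%:R ^+ c), i.
  by rewrite -exprnP rmorphM rmorphXn /= rmorph_nat mulrAC.
by exists l, (i + c.+1)%N; rewrite NegzE -exprnN exprD invfM mulrA.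
Qed.

Definition Zinv_mulX n (x : Zinv n) (c : int) : Zinv n :=
  MkZinv (Zinv_mul_closed x c).

(* The proof of 1 < n is a parameter of the type because the product below is
   a group law only for n > 0. *)
Definition BS (n : nat) (hn : (1 < n)%N) : Type := (Zinv n * int)%type.

Section BaumslagSolitar.
Variables (n : nat) (hn : (1 < n)%N).
Implicit Types x y z : BS hn.

Definition BS_mul x y : BS hn := (Zinv_mulX x.1 y.2 + y.1, x.2 + y.2).
Definition BS_one : BS hn := (0, 0).
Definition BS_inv x : BS hn := (- Zinv_mulX x.1 (- x.2), - x.2).

Let n_neq0 : (n%:R : rat) != 0.
Proof. by rewrite Num.Theory.pnatr_eq0 -lt0n ltnW. Qed.

Lemma BS_mulA : associative BS_mul.
Proof.
move=> [a i] [b j] [c k]; congr pair; last exact: addrA.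
by apply: val_inj; rewrite /= expfzDr // mulrDl !mulrA addrA.
Qed.

Lemma BS_1mul : left_id BS_one BS_mul.
Proof.
by move=> [a i]; congr pair; rewrite ?add0r //; apply: val_inj; rewrite /= mul0r add0r.
Qed.

Lemma BS_mul1 : right_id BS_one BS_mul.
Proof.
by move=> [a i]; congr pair; rewrite ?addr0 //; apply: val_inj; rewrite /= expr0z mulr1.
Qed.

Lemma BS_mulV : left_inverse BS_one BS_inv BS_mul.
Proof.
move=> [a i]; congr pair; rewrite ?addNr //; apply: val_inj.
by rewrite /= mulNr -mulrA -expfzDr // addNr expr0z mulr1 addNr.
Qed.

Lemma BS_Vmul : right_inverse BS_one BS_inv BS_mul.
Proof.
by move=> [a i]; congr pair; rewrite ?subrr //; apply: val_inj; rewrite /= subrr.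
Qed.

HB.instance Definition _ := Choice.on (BS hn).
HB.instance Definition _ :=
  isGroup.Build (BS hn) BS_mulA BS_1mul BS_mul1 BS_mulV BS_Vmul.

End BaumslagSolitar.

Local Open Scope classical_set_scope.

Definition group_aut (G : groupType) : set (G -> G) :=
  [set phi | {morph phi : x y / (x * y)%g} /\ bijective phi].

Definition Stab (G : groupType) (g : G) : set (G -> G) :=
  [set phi | group_aut phi /\ phi g = g].

(* Main.v *)
Require Import Defs.
From HB Require Import structures.
From mathcomp Require Import all_boot all_order all_algebra.
From mathcomp Require Import boolp classical_sets.

(** An automorphism fixing [g ^+ k] sends [g] to a [k]-th root of [g ^+ k], so
    it suffices that [k]-th roots are unique. In [BS(1, n)] the [k]-th power of
    [(gamma, c)] is [(gamma * (1 + n^c + ... + n^((k-1)c)), k c)]: the second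
    entry determines [c], and then [gamma] is determined because the sum is
    positive. *)

Set Implicit Arguments.
Unset Strict Implicit.
Unset Printing Implicit Defensive.

Import GRing.Theory Num.Theory.
Local Open Scope ring_scope.

Lemma morph_expgS (G H : groupType) (phi : G -> H) :
  {morph phi : x y / (x * y)%g} ->
  forall k, {morph phi : x / (x ^+ k.+1)%g >-> (x ^+ k.+1)%g}.
Proof.
move=> phiM k x; elim: k => [|k IHk]; first by rewrite !expg1.
by rewrite expgS phiM IHk -expgS.
Qed.

Section Powers.
Variables (n : nat) (hn : (1 < n)%N).
Implicit Types x y : BS hn.

Lemma BS_expg_snd x k : (x ^+ k)%g.2 = x.2 *+ k.
Proof. by elim: k => [|k IHk] //; rewrite expgS mulrS -IHk. Qed.

Lemma BS_expg_fst x k :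
  val (x ^+ k)%g.1 = val x.1 * \sum_(i < k) n%:R ^ (x.2 *+ i).
Proof.
elim: k => [|k IHk]; first by rewrite big_ord0 mulr0.
(* In [x * x ^+ k] the right factor scales [x.1] by [n] to the power of its second entry,
   [x.2 *+ k]: this is the last summand. *)
by rewrite big_ord_recr mulrDr -IHk -BS_expg_snd addrC expgS.
Qed.

Lemma BS_expg_inj k : injective (fun x : BS hn => x ^+ k.+1)%g.
Proof.
move=> x y /= eq_xy.
have eq2 : x.2 = y.2.
  by move/(congr1 snd): eq_xy; rewrite !BS_expg_snd => /eqP; rewrite eqrMn2r // => /eqP.
have n_gt0 : 0 < n%:R :> rat by rewrite ltr0n ltnW.
have sum_neq0 : \sum_(i < k.+1) (n%:R : rat) ^ (y.2 *+ i) != 0.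
  (* The summand at [i = 0] is strictly positive, so the rest, empty when [k = 0], need only be
     nonnegative. *)
  rewrite big_ord_recl lt0r_neq0 // ltr_pwDl ?exprz_gt0 //.
  by apply: sumr_ge0 => i _; rewrite exprz_ge0 // ltW.
have eq1 : x.1 = y.1.
  apply: val_inj; apply: (mulIf sum_neq0).
  (* The right side folds into a power of [y] at once; the left side pairs [x.1] with exponents from
     [y.2] until [eq2] rewrites them. *)
  by rewrite -BS_expg_fst -eq2 -BS_expg_fst eq_xy.
by case: x y eq1 eq2 {eq_xy sum_neq0} => [a c] [b d] /= -> ->.
Qed.

End Powers.

Theorem theorem3p7 (n : nat) (hn : (1 < n)%N) (gamma : Zinv n) (c : int)
    (k : nat) (hk : (1 <= k)%N) :
  Stab ((gamma, c) : BS hn) = Stab (((gamma, c) : BS hn) ^+ k)%g.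
Proof.
case: k hk => // k _; apply/seteqP; split=> phi /= [[phiM phi_bij] phi_fix];
  split=> //; first by rewrite morph_expgS // phi_fix.
by apply: (@BS_expg_inj n hn k); apply: etrans phi_fix; rewrite morph_expgS.
Qed.
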